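(* There is a Borel measurable mapping $T \colon \mathcal{K}(Q) \to C(\mathcal{C},Q)$ such that for every $K \in \mathcal{K}(Q)$, the image of $\mathcal{C}$ under $T(K)$ is equal to $K$.
   Context: $\mathcal{C} = \{0,1\}^{\mathbb{N}}$ is the Cantor space (product topology) and $Q = [0,1]^{\mathbb{N}}$ is the Hilbert cube (product topology). $\mathcal{K}(Q)$ is the space of all nonempty compact subsets of $Q$ with the Vietoris topology (equivalently, the topology of the Hausdorff metric). $C(\mathcal{C},Q)$ is the space of all continuous mappings from $\mathcal{C}$ to $Q$ with the topology of uniform convergence (equivalently, the compact-open topology). A mapping between topological spaces is Borel measurable if preimages of open sets are Borel. *)

(* Defs.v *)
From HB Require Import structures.
From mathcomp Require Import all_boot all_order all_algebra.
From mathcomp Require Import all_classical all_reals all_analysis.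

Set Implicit Arguments.
Unset Strict Implicit.
Unset Printing Implicit Defensive.

Import Order.TTheory GRing.Theory Num.Theory.
Import numFieldNormedType.Exports.

Local Open Scope classical_set_scope.
Local Open Scope ring_scope.

Definition hilbert_cube (R : realType) : Type :=
  prod_topology (fun _ : nat => set_type (`[0, 1]%classic : set R)).

HB.instance Definition _ (R : realType) := Uniform.on (hilbert_cube R).

Definition hyperspace (X : topologicalType) : Type :=
  set_type [set K : set X | K !=set0 /\ compact K].

HB.instance Definition _ (X : topologicalType) := Choice.on (hyperspace X).

(* The Vietoris topology: the sets K included in U and the sets K meeting U,
   for U open, form a subbase. *)
Definition vietoris_subbase (X : topologicalType) : set (set (hyperspace X)) :=
  [set [set K : hyperspace X | val K `<=` U] | U in open] `|`
  [set [set K : hyperspace X | val K `&` U !=set0] | U in open].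

HB.instance Definition _ (X : topologicalType) :=
  isSubBaseTopological.Build (hyperspace X) (@vietoris_subbase X) id.

(* [continuousType X Y] may receive several topologies, depending on which
   [ArrowAs*] module is imported; this alias fixes the one induced by
   [{uniform X -> Y}]. *)
Definition uniform_continuousType (X : topologicalType) (Y : uniformType) :
  Type := continuousType X Y.

HB.instance Definition _ (X : topologicalType) (Y : uniformType) :=
  Uniform.copy (uniform_continuousType X Y)
    (initial_topology
      (fun f : continuousType X Y => (f : X -> Y) : {uniform X -> Y})).

Definition borel_measurable (X Y : topologicalType) (f : X -> Y) : Prop :=
  forall U : set Y, open U -> <<s (@open X) >> (f @^-1` U).

(* Main.v *)
Require Import Defs.
From mathcomp Require Import all_boot all_order all_algebra.
From mathcomp Require Import all_classical all_reals all_analysis.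
From mathcomp Require Import finmap.
From HB Require Import structures.

Import Order.TTheory Num.Theory.
Import numFieldNormedType.Exports.

Local Open Scope classical_set_scope.

(** Fix a continuous surjection [phi] of the Cantor space onto the Hilbert cube
    ([hilbert_cube_cantor_image]: the cube is compact metrizable).  Every
    nonempty closed [F] in the Cantor space is a retract of it: to compute
    [r_F x], follow the bits of [x], flipping the next bit whenever keeping it
    would lead to a finite word that no point of [F] extends.  Hence, with
    [F := phi^-1 K], the map [T K := phi \o r_F] is continuous with image [K].

    [T] is Borel because [r_F] is computed digit by digit.  The first [n] bits
    of [r_F x] depend on [F] only through the words of length at most [n] that
    are prefixes of points of [F] ([greedy_walk_prefix_tree]), and [phi] is
    uniformly continuous.  So if [T K] lies in an open set [U], there is an [n]
    such that [T L] lies in [U] for all [L] whose preimage has the same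
    prefixes up to length [n] as that of [K]
    ([parametrization_locally_determined]).  The preimage of [U] under [T] is
    thus a countable union of sets, the [n]-th of which is determined by the
    truth values of the finitely many conditions
      [s] is a prefix of a point of [phi^-1 K],  [size s <= n].
    Each condition says that [K] meets the compact set [phi (cylinder s)], and
    so it fails on a Vietoris open set ([prefix_tree_preimage_borel]). *)

(** * The greedy retraction onto a closed subset of the Cantor space *)

Definition cylinder (s : seq bool) : set cantor_space :=
  [set y | mkseq y (size s) = s].

Definition prefix_tree (F : set cantor_space) : set (seq bool) :=
  [set s | F `&` cylinder s !=set0].

Lemma mkseq_le {x y : cantor_space} {m n : nat} :
  (m <= n)%N -> mkseq x n = mkseq y n -> mkseq x m = mkseq y m.
Proof.
move=> mn xy; apply/eq_in_map => i; rewrite mem_iota add0n => /andP[_ im].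
have := congr1 (nth false ^~ i) xy.
by rewrite !nth_mkseq // (leq_trans im mn).
Qed.

Section GreedyRetraction.
Variable F : set cantor_space.

(** The first [n] bits of the image of [x] under the retraction.  Finite words
    are built first because the next bit depends on the bits chosen so far,
    not on those of [x]. *)
Fixpoint greedy_walk (x : cantor_space) (n : nat) : seq bool :=
  if n is m.+1 then
    let w := greedy_walk x m in
    rcons w (if `[< prefix_tree F (rcons w (x m)) >] then x m else ~~ x m)
  else [::].

Definition retraction (x : cantor_space) : cantor_space :=
  fun n => nth false (greedy_walk x n.+1) n.

Lemma size_greedy_walk x n : size (greedy_walk x n) = n.
Proof. by elim: n => //= n IHn; rewrite size_rcons IHn. Qed.

Lemma mkseq_retraction x n : mkseq (retraction x) n = greedy_walk x n.
Proof.
elim: n => // n IHn; rewrite mkseqS IHn /= /retraction /=.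
by rewrite nth_rcons size_greedy_walk ltnn eqxx.
Qed.

Lemma prefix_tree_rcons s : prefix_tree F s ->
  exists b, prefix_tree F (rcons s b).
Proof.
move=> [y [Fy ys]]; exists (y (size s)), y; split => //.
by rewrite /cylinder /= size_rcons mkseqS ys.
Qed.

(** The walk never gets stuck: a word in the tree has an extension by one bit in
    the tree, so when the bit of [x] is refused its negation is accepted. *)
Lemma prefix_tree_greedy_walk x n : F !=set0 -> prefix_tree F (greedy_walk x n).
Proof.
move=> [y Fy]; elim: n => [|n IHn] /=; first by exists y.
case: asboolP => // nlive; have [b] := prefix_tree_rcons _ IHn.
by have [<- //|] := eqVneq (x n) b; case: (x n) b nlive => [] [].
Qed.

Lemma greedy_walk_id x n : F x -> greedy_walk x n = mkseq x n.
Proof.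
move=> Fx; elim: n => // n IHn; rewrite mkseqS /= IHn asboolT//.
by exists x; split=> //; rewrite /cylinder /= size_rcons size_mkseq mkseqS.
Qed.

Lemma retraction_id x : F x -> retraction x = x.
Proof.
move=> Fx; apply/funext => n.
by rewrite /retraction greedy_walk_id // nth_mkseq.
Qed.

(** This makes the retraction 1-Lipschitz, whatever the set [F]. *)
Lemma greedy_walk_prefix x y n :
  mkseq x n = mkseq y n -> greedy_walk x n = greedy_walk y n.
Proof.
elim: n => // n IHn; rewrite !mkseqS => /rcons_inj[/IHn eqw eqn] /=.
by rewrite eqw eqn.
Qed.

End GreedyRetraction.

(** Finite information on the set determines finitely many output bits: this is
    the source of the Borel measurability of the parametrization. *)
Lemma greedy_walk_prefix_tree F G x n :
  (forall s, (size s <= n)%N -> prefix_tree F s <-> prefix_tree G s) ->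
  greedy_walk F x n = greedy_walk G x n.
Proof.
elim: n => // n IHn FG /=; rewrite IHn; last first.
  by move=> s sn; apply: FG; exact: leqW.
by rewrite (asbool_equiv_eq (FG (rcons _ _) _)) ?size_rcons ?size_greedy_walk.
Qed.

(** * Cylinders and the topology of the Cantor space *)

Lemma nbhs_cylinder (x : cantor_space) n :
  \forall y \near x, mkseq y n = mkseq x n.
Proof.
elim: n => [|n IHn]; first by apply: filterE.
have xn : \forall y \near x, y n = x n.
  exact: (@proj_continuous nat (fun _ => bool) n x _ (discrete_set1 (x n))).
by near=> y; rewrite !mkseqS; congr rcons; near: y.
Unshelve. all: by end_near. Qed.

(** By compactness: a point [y] outside an open neighbourhood of [x] differs from
    [x] at some coordinate [i], hence so do all points near [y], and none of
    them shares more than [i] bits with [x].  Finitely many such coordinates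
    [i] suffice for the whole complement. *)
Lemma nbhs_cantorP (x : cantor_space) (U : set cantor_space) :
  nbhs x U -> exists n, forall y, mkseq y n = mkseq x n -> U y.
Proof.
rewrite nbhsE => -[V [oV Vx] VU].
have /compact_near_coveringP := cantor_space_compact.
move=> /(_ nat \oo (fun n y => mkseq y n = mkseq x n -> U y) _) [].
  move=> y _; have [Vy|nVy] := pselect (V y).
    exists (V, setT) => /=; last by move=> [z n] [/= /VU].
    by split; [exact: open_nbhs_nbhs|exact: filterT].
  have [i xyi] : exists i, y i <> x i.
    by apply/existsNP => /funext yx; rewrite yx in nVy.
  exists ([set z | mkseq z i.+1 = mkseq y i.+1], [set n | (i < n)%N]) => /=.
    by split; [exact: nbhs_cylinder|exact: nbhs_infty_gt].
  move=> [z n] /= [zy lin] zx; exfalso; apply: xyi.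
  have := mkseq_le lin zx; rewrite zy => /(congr1 (nth false ^~ i)).
  by rewrite !nth_mkseq.
move=> N _ HN; exists N => y; apply: HN => //=; exact: leqnn.
Qed.

Lemma cylinder_closed s : closed (cylinder s).
Proof.
move=> x clx; have [y [ys yx]] := clx _ (nbhs_cylinder x (size s)).
by rewrite /cylinder /= -yx.
Qed.

(** All the prefixes of [retraction F x] are prefixes of points of [F], so it is
    a limit of points of [F]. *)
Lemma retraction_in F x : closed F -> F !=set0 -> F (retraction F x).
Proof.
move=> clF F0; apply: clF => U /nbhs_cantorP[n Un].
have [y [Fy]] := prefix_tree_greedy_walk F x n F0.
rewrite /cylinder /= size_greedy_walk -mkseq_retraction => yx.
by exists y; split=> //; exact: Un.
Qed.

(** The Heine-Cantor theorem, with the uniformity of the Cantor space expressed by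
    common prefixes. *)
Lemma cantor_unif_continuous (X : uniformType) (phi : cantor_space -> X)
    (E : set (X * X)) : continuous phi -> entourage E ->
  exists n, forall x y, mkseq x n = mkseq y n -> E (phi x, phi y).
Proof.
move=> phic entE.
have /compact_near_coveringP := cantor_space_compact.
move=> /(_ nat \oo
  (fun n x => forall y, mkseq x n = mkseq y n -> E (phi x, phi y)) _) [].
  move=> x _.
  have /nbhs_cantorP[m xm] :=
    phic x _ (nbhs_entourage (phi x) (entourage_split_ent entE)).
  have /nbhs_cantorP[m' xm'] :=
    phic x _ (nbhs_entourage (phi x) (entourage_inv (entourage_split_ent entE))).
  (* Two moduli, since the triangle inequality through [phi x] needs one pair
     ending at [phi x] and one starting there. *)
  exists ([set z | mkseq z (maxn m m') = mkseq x (maxn m m')],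
          [set n | (maxn m m' <= n)%N]) => /=.
    by split; [exact: nbhs_cylinder|exact: nbhs_infty_ge].
  move=> [z n] /= [zx mn] y zy.
  apply: (entourage_split (phi x)) => //.
    apply/xsectionP/xm'; exact: mkseq_le (leq_maxr _ _) zx.
  apply/xsectionP/xm; apply: mkseq_le (leq_maxl _ m') _.
  by rewrite -zx; apply/esym/(mkseq_le mn).
move=> N _ HN; exists N => x; apply: HN => //=; exact: leqnn.
Qed.

(** * Sets determined by finitely many measurable conditions *)

(** Such a set is a union of atoms of the finite Boolean algebra that the
    conditions generate; an atom is coded by the set of conditions that hold
    on it. *)
Lemma sigma_algebra_determined (T : choiceType) (G : set (set T))
    (I : finType) (S : I -> set T) (A : set T) :
  (forall i, <<s G >> (S i)) ->
  (forall x y, (forall i, S i x <-> S i y) -> A x -> A y) -> <<s G >> A.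
Proof.
move=> GS SA; have [->|/set0P[x0 _]] := eqVneq A set0.
  exact: sigma_algebra0.
(* A nonempty [A] provides the base point that a measurable space carries. *)
pose pT : pointedType := HB.pack T (isPointed.Build T x0).
pose M : measurableType _ := @g_sigma_algebraType pT G.
have mS i : measurable (S i : set M) by exact: GS.
pose code x := [set i | `[< S i x >]]%SET.
pose atom (c : {set I}) : set M :=
  \bigcap_(i in [set: I]) (if i \in c then S i else ~` S i).
have atomP x y : atom (code x) y <-> forall i, S i x <-> S i y.
  split=> [xy i|xy i _]; rewrite ?inE.
    by have := xy i Logic.I; rewrite inE; case: asboolP.
  by case: asboolP => Sx; [apply/xy|move=> /xy].
have -> : A = \bigcup_(c in code @` A) atom c.
  apply/seteqP; split=> [x Ax|y [_ [x Ax <-] /atomP/SA]]; last exact.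
  by exists (code x); [exists x|apply/atomP].
suff : measurable (\bigcup_(c in code @` A) atom c) by [].
apply: fin_bigcup_measurable; first exact: finite_finset.
move=> c _; apply: fin_bigcap_measurable; first exact: finite_finset.
by move=> i _; case: ifP => // _; exact: measurableC.
Qed.

(** * The Hilbert cube is a continuous image of the Cantor space *)

Lemma subtype_hausdorff (X : topologicalType) (A : set X) :
  hausdorff_space X -> hausdorff_space (set_type A).
Proof.
move=> hX x y xy; apply/val_inj/hX => U V xU yV.
have [z [Uz Vz]] := xy _ _ (@initial_continuous _ _ set_val x _ xU)
  (@initial_continuous _ _ set_val y _ yV).
by exists (set_val z).
Qed.

(** The image under the inclusion of a filter on the subtype clusters in [A]; as
    the subtype has the initial topology, the filter clusters at that point. *)
Lemma subtype_compact (X : topologicalType) (A : set X) :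
  compact A -> compact [set: set_type A].
Proof.
move=> cA F PF _.
have FA : (set_val @ F) A.
  suff : F (set_val @^-1` A) by [].
  have -> : set_val @^-1` A = [set: set_type A]; last exact: filterT.
  by apply/seteqP; split=> // -[x xA] _; exact: set_mem xA.
have [p [Ap clp]] := cA (set_val @ F) _ FA.
exists (exist _ p (mem_set Ap)); split=> // U V FU.
rewrite nbhsE => -[_ [[W oW <-] Wp] WV].
have FU' : (set_val @ F) (set_val @` U).
  suff : F (set_val @^-1` (set_val @` U)) by [].
  by apply: filterS FU; exact: preimage_image.
have [_ [[x Ux <-] Wx]] := clp _ _ FU' (open_nbhs_nbhs (conj oW Wp)).
by exists x; split=> //; exact: WV.
Qed.

Lemma hilbert_cube_hausdorff (R : realType) : hausdorff_space (hilbert_cube R).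
Proof.
apply: hausdorff_product => _; apply: subtype_hausdorff.
exact: Rhausdorff.
Qed.

Lemma hilbert_cube_compact (R : realType) : compact [set: hilbert_cube R].
Proof.
have := @tychonoff nat (fun=> _) _
  (fun=> subtype_compact _ _ (@segment_compact R 0%R 1%R)).
by congr (compact _); rewrite eqEsubset.
Qed.

(** The Alexandroff-Hausdorff theorem, applied to the cube with its product
    pseudometric and an arbitrary base point. *)
Lemma hilbert_cube_cantor_image (R : realType) :
  exists phi : cantor_space -> hilbert_cube R,
    continuous phi /\ forall q, exists x, phi x = q.
Proof.
have i0 : (0%R : R) \in (`[0%R, 1%R]%classic : set R).
  by apply/mem_set; rewrite /= in_itv /= lexx ler01.
pose p : hilbert_cube R := fun=> exist _ 0%R i0.
pose Q : pseudoPMetricType R := HB.pack (hilbert_cube R)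
  (PseudoMetric.on (prod_topology
     (fun _ : nat => set_type (`[0%R, 1%R]%classic : set R))))
  (isPointed.Build (hilbert_cube R) p).
have [phi phic] :=
  @cantor_surj R Q (hilbert_cube_compact R) (hilbert_cube_hausdorff R).
exists phi; split=> // q.
by have [x _ <-] := @surj _ _ _ _ phi q Logic.I; exists x.
Qed.

(** * The parametrization of compact sets *)

Lemma open_vietoris_subbase (X : topologicalType) (A : set (hyperspace X)) :
  vietoris_subbase A -> open A.
Proof.
move=> subA; exists [set A]; last by rewrite bigcup_set1.
move=> _ ->; exists [fset A]%fset; first by move=> B /fset1P ->; exact/mem_set.
by rewrite set_fset1 bigcap_set1.
Qed.

Section Parametrization.
Context (X : uniformType) (phi : cantor_space -> X).
Hypotheses (hX : hausdorff_space X) (phic : continuous phi).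

(** The condition says that [K] meets [phi @` cylinder s], which is compact, hence
    closed; it fails when [K] is included in the open complement. *)
Lemma prefix_tree_preimage_borel s :
  <<s @open (hyperspace X) >>
    [set K : hyperspace X | prefix_tree (phi @^-1` val K) s].
Proof.
pose C := phi @` cylinder s.
have clC : closed C.
  apply: compact_closed => //; apply: continuous_compact.
    exact: continuous_subspaceT.
  by apply: subclosed_compact (cylinder_closed s) cantor_space_compact _.
have -> : [set K : hyperspace X | prefix_tree (phi @^-1` val K) s] =
    [set: hyperspace X] `\` [set K | val K `<=` ~` C].
  apply/seteqP; split=> K /=.
    by move=> [y [Ky sy]]; split=> // /(_ _ Ky); apply; exists y.
  move=> [_ /existsNP[x /not_implyP[Kx /contrapT[y sy yx]]]].
  by exists y; split=> //=; rewrite yx.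
apply: sigma_algebraCD; apply: sub_sigma_algebra.
by apply: open_vietoris_subbase; left; exists (~` C) => //; exact: closed_openC.
Qed.

(** The retraction maps points with [n] common bits to points with [n] common
    bits, and [phi] maps these to close points when [n] is large. *)
Lemma parametrization_continuous F : continuous (phi \o retraction F).
Proof.
move=> x U; rewrite -nbhs_entourageE => -[E entE EU].
have [n phin] := cantor_unif_continuous _ _ _ phic entE.
rewrite /= nbhs_simpl; apply: filterS (nbhs_cylinder x n) => y yx.
apply/EU/xsectionP/phin; rewrite !mkseq_retraction.
exact/esym/greedy_walk_prefix.
Qed.

Definition parametrization (K : hyperspace X) :
    uniform_continuousType cantor_space X :=
  mkcts (parametrization_continuous (phi @^-1` val K)).

(** A neighbourhood of [parametrization K] contains all maps uniformly close to it;
    when the two trees agree up to level [n], the two retractions agree on the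
    first [n] bits at every point, and [phi] turns this into uniform closeness. *)
Lemma parametrization_locally_determined U K :
  open U -> U (parametrization K) -> exists n, forall L,
    (forall s, (size s <= n)%N -> prefix_tree (phi @^-1` val K) s <->
                                  prefix_tree (phi @^-1` val L) s) ->
    U (parametrization L).
Proof.
move=> oU UK.
have [_ [[W oW <-] WK] WU] := open_nbhs_nbhs (conj oU UK).
have /uniform_nbhs[E [entE EW]] := open_nbhs_nbhs (conj oW WK).
have [n phin] := cantor_unif_continuous _ _ _ phic entE.
exists n => L KL; apply/WU/EW => x _; apply: phin.
by rewrite !mkseq_retraction; exact: greedy_walk_prefix_tree.
Qed.

(** The [n]-th set of the union below is saturated for agreement up to level [n],
    a condition on finitely many words, and therefore Borel. *)
Lemma parametrization_borel : borel_measurable parametrization.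
Proof.
move=> U oU.
pose level n (K L : hyperspace X) := forall s : n.-bseq bool,
  prefix_tree (phi @^-1` val K) s <-> prefix_tree (phi @^-1` val L) s.
have -> : parametrization @^-1` U =
    \bigcup_n [set K | forall L, level n K L -> U (parametrization L)].
  apply/seteqP; split=> [K UK|K [n _]]; last exact.
  have [n Un] := parametrization_locally_determined U K oU UK.
  by exists n => // L KL; apply: Un => s sn; exact: (KL (Bseq sn)).
apply: sigma_algebra_bigcup => n.
apply: (@sigma_algebra_determined _ _ {: n.-bseq bool}
  (fun s => [set K : hyperspace X | prefix_tree (phi @^-1` val K) s])).
  by move=> s; exact: prefix_tree_preimage_borel.
move=> K L KL UK M LM; apply: UK => s.
exact: iff_trans (KL s) (LM s).
Qed.

Lemma parametrization_image K : (forall q, exists x, phi x = q) ->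
  parametrization K @` [set: cantor_space] = val K.
Proof.
move=> phisurj; have [[q Kq] cK] := set_mem (svalP K).
apply/seteqP; split=> [_ [x _ <-]|p Kp].
  apply: (retraction_in (phi @^-1` val K)).
    apply: preimage_closed; [by move=> ? _; exact: phic|exact: compact_closed].
  by have [z zq] := phisurj q; exists z; rewrite /= zq.
have [x xp] := phisurj p; exists x => //.
rewrite -[LHS]/(phi (retraction (phi @^-1` val K) x)) retraction_id //=.
by rewrite xp.
Qed.

End Parametrization.

Theorem theoremA (R : realType) :
  exists T : hyperspace (hilbert_cube R) ->
             uniform_continuousType cantor_space (hilbert_cube R),
    borel_measurable T /\
    forall K : hyperspace (hilbert_cube R), T K @` [set: cantor_space] = val K.
Proof.
have [phi [phic phisurj]] := hilbert_cube_cantor_image R.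
exists (parametrization _ phi phic); split.
  exact: (parametrization_borel _ phi (hilbert_cube_hausdorff R) phic).
move=> K.
exact: (parametrization_image _ phi (hilbert_cube_hausdorff R) phic K phisurj).
Qed.
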